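(* Let $d\equiv 2\pmod 4$ be a positive integer which is not square-free. Then $M_{even}'(d)\leq 2$ if and only if $d\in\{18,50,54,90,98\}$.
   Context: For an integer $n\geq 2$, $\omega(n)$ denotes the number of distinct prime divisors of $n$. For an integer $d\geq 4$ with $d\equiv 2\pmod 4$, $M_{even}'(d):=\max\{\omega(d-x^2) : x \text{ an even integer with } 2\leq x\leq\sqrt d\}$. *)

(* Defs.v *)
From mathcomp Require Import all_boot.

Set Implicit Arguments.
Unset Strict Implicit.
Unset Printing Implicit Defensive.

Definition omega (n : nat) : nat := size (primes n).

Definition square_free (n : nat) : Prop := forall m : nat, m ^ 2 %| n -> m = 1.

(* The range 2 <= x <= sqrt d is written 2 <= x, x ^ 2 <= d; the bound          *)
(* x < d.+1 only makes it finite.  For d = 2 %[mod 4], d is not a square, so    *)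
(* the subtraction is never truncated and d - x ^ 2 >= 2.  The range is         *)
(* nonempty exactly when 4 <= d; otherwise the value is 0.                      *)
Definition Meven' (d : nat) : nat :=
  \max_(2 <= x < d.+1 | ~~ odd x && (x ^ 2 <= d)) omega (d - x ^ 2).

(* Main.v *)
Require Import Defs.
From mathcomp Require Import all_boot.
From mathcomp Require Import zify.

Set Implicit Arguments.
Unset Strict Implicit.
Unset Printing Implicit Defensive.

(** Every value [d - x ^ 2] in the range is twice an odd number, so a bound of
    2 on [omega] says that its odd part is a prime power: as soon as one odd
    prime [p] is known to divide [d - (2 * y) ^ 2], that number is [2 * p ^ j]
    ([forced_prime_power]).  The proof plays this prescription off for several
    [y] and a well-chosen [p].

    As [d] is not square-free and 4 does not divide it, [d = p ^ 2 * (2 * m)]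
    with [p] an odd prime and [m] odd.  Taking [y = p * k] forces
    [m = 2 * k ^ 2 + p ^ a] whenever [2 * k ^ 2 < m].  The three equations for
    [k = 1, 2, 3] are incompatible ([cofactor_powers_incompatible]), so
    [m <= 17], and the equations for [k = 1, 2] leave [m = 1] and [m = 3], with
    [p] arbitrary, and four single values of [d], three of which are excluded by
    an explicit [x].

    For [d = 6 * p ^ 2] the auxiliary prime is 3, with [y = 3]: a large power of
    3 would force 3 to divide [p].  For [d = 2 * p ^ 2] it is 7: since 2 is a
    square modulo 7, some [y] in 1, 2, 3 makes both [p ^ 2 - 2 * y ^ 2] and
    [p ^ 2 - 2 * (7 - y) ^ 2] divisible by 7, hence powers of 7, but they differ
    by 14, 42 or 70, so the smaller one is 7 and [p ^ 2] would be 39, 57 or 79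
    ([power7_gap]).  All these [y], up to 6, are in the range once [p >= 11];
    the primes 3, 5 and 7 give the values 18, 50 and 98. *)

(** * Consequences of the bound on [Meven'] *)

Lemma omega_le_Meven' d x :
  2 <= x -> ~~ odd x -> x ^ 2 <= d -> omega (d - x ^ 2) <= Meven' d.
Proof.
move=> x_ge2 x_even x2_le_d; apply: (@leq_bigmax_seq _ _ _ (fun x => omega (d - x ^ 2))).
  by rewrite mem_index_iota x_ge2 ltnS (leq_trans _ x2_le_d) // leq_pmulr; lia.
by rewrite x_even.
Qed.

Lemma omega_le2_pfactor n p :
  n %% 4 = 2 -> prime p -> odd p -> p %| n -> omega n <= 2 ->
  exists j, n = 2 * p ^ j.
Proof.
move=> n_mod4 p_pr p_odd p_dvd_n omega_n.
have [r def_n r_odd] : exists2 r, n = 2 * r & odd r by exists (n %/ 2); lia.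
have r_gt0 : 0 < r by lia.
suff /p_natP[j def_r] : p.-nat r by exists j; rewrite def_n def_r.
apply/pnatP => // q q_pr q_dvd_r; rewrite inE; apply: contraTT omega_n => q_neq_p.
have q_odd : odd q := dvdn_odd q_dvd_r r_odd.
(* Otherwise [2], [p] and [q] are three distinct prime factors of [n]. *)
have sub : {subset [:: 2; p; q] <= primes n}.
  move=> s; rewrite !inE mem_primes => /or3P[] /eqP->.
  - by rewrite def_n dvdn_mulr // muln_gt0 r_gt0.
  - by rewrite p_pr p_dvd_n andbT; lia.
  - by rewrite q_pr def_n dvdn_mull // muln_gt0 r_gt0.
rewrite -ltnNge; apply: (uniq_leq_size _ sub).
rewrite /= !inE eq_sym in q_neq_p *.
by rewrite q_neq_p !andbT; apply/norP; split; apply/eqP; lia.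
Qed.

(** Since [d - (2 * y) ^ 2] is 2 modulo 4, one odd prime factor [p] uses up
    the two primes allowed.  The conclusion avoids subtraction so that the
    equations for several [y] can be compared. *)
Lemma forced_prime_power d p y :
  d %% 4 = 2 -> Meven' d <= 2 -> prime p -> odd p ->
  0 < y -> 4 * y ^ 2 < d -> p %| d - 4 * y ^ 2 ->
  exists j, d = 4 * y ^ 2 + 2 * p ^ j.
Proof.
move=> d_mod4 d_le2 p_pr p_odd y_gt0 y_small.
have -> : 4 * y ^ 2 = (2 * y) ^ 2 by rewrite expnMn.
have sq : (2 * y) ^ 2 = 4 * y ^ 2 by rewrite expnMn.
move=> p_dvd; have [||j def_d] := omega_le2_pfactor _ p_pr p_odd p_dvd.
- by rewrite sq; lia.
- by apply: leq_trans d_le2; apply: omega_le_Meven'; rewrite ?sq; lia.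
by exists j; rewrite -def_d; lia.
Qed.

(** * The square factor *)

Lemma odd_prime_square_divisor d :
  d %% 4 = 2 -> ~ square_free d ->
  exists p m, [/\ prime p, odd p, odd m & d = p ^ 2 * (2 * m)].
Proof.
move=> d_mod4 d_nsqf; have d_gt0 : 0 < d by lia.
have [/hasP[p]|no_square] := boolP (has (fun p => p ^ 2 %| d) (primes d)).
  rewrite mem_primes => /and3P[p_pr _ _] /dvdnP[e def_d].
  have p_odd : odd p.
    case: (even_prime p_pr) => // p2; move: def_d; rewrite p2 => def_d.
    by rewrite def_d modnMl in d_mod4.
  have p2_mod4 : p ^ 2 %% 4 = 1.
    rewrite -modnXm.
    have : p %% 4 = 1 \/ p %% 4 = 3 by lia.
    by case=> ->.
  have e_mod4 : e %% 4 = 2 by move: d_mod4; rewrite def_d -modnMmr p2_mod4 muln1.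
  exists p, (e %/ 2); split=> //; first by lia.
  by rewrite def_d mulnC; congr (_ * _); lia.
case: d_nsqf => m m2_dvd; have [//|m_neq1] := eqVneq m 1.
have m_gt0 : 0 < m by case: m m2_dvd {m_neq1} => // /[!dvd0n]; lia.
have p_pr : prime (pdiv m) by rewrite pdiv_prime //; lia.
have p2_dvd : pdiv m ^ 2 %| d by apply: dvdn_trans m2_dvd; rewrite dvdn_exp2r ?pdiv_dvd.
case/hasP: no_square; exists (pdiv m) => //.
by rewrite mem_primes p_pr d_gt0 (dvdn_trans _ p2_dvd) // dvdn_mulr.
Qed.

Lemma cofactor_prime_power p m k :
  prime p -> odd p -> odd m -> Meven' (p ^ 2 * (2 * m)) <= 2 ->
  0 < k -> 2 * k ^ 2 < m -> exists a, m = 2 * k ^ 2 + p ^ a.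
Proof.
move=> p_pr p_odd m_odd le2 k_gt0 k_small; have p_gt0 := prime_gt0 p_pr.
have d_mod4 : p ^ 2 * (2 * m) %% 4 = 2.
  have p2m_odd : odd (p ^ 2 * m) by rewrite oddM oddX p_odd.
  by rewrite mulnCA; lia.
have eq_sq : 4 * (p * k) ^ 2 = p ^ 2 * (2 * (2 * k ^ 2)) by rewrite expnMn; lia.
have [|||j def_d] := @forced_prime_power _ p (p * k) d_mod4 le2 p_pr p_odd.
- by rewrite muln_gt0 p_gt0.
- by rewrite eq_sq ltn_pmul2l ?expn_gt0 ?p_gt0 // ltn_pmul2l.
- by rewrite eq_sq -mulnBr dvdn_mulr // dvdn_mulr.
have def_pj : p ^ j = p ^ 2 * (m - 2 * k ^ 2) by rewrite mulnBr; lia.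
have /(dvdn_pfactor _ _ p_pr)[a _ def_a] : m - 2 * k ^ 2 %| p ^ j.
  by rewrite def_pj dvdn_mull.
by exists a; lia.
Qed.

Lemma prime_eq_base p q a : prime p -> prime q -> q = p ^ a -> p = q.
Proof.
move=> p_pr q_pr def_q; have : q %| p ^ a by rewrite -def_q.
by rewrite Euclid_dvdX // => /andP[+ _]; rewrite dvdn_prime2 // => /eqP.
Qed.

(** If [0 < c], then [p] divides all three powers, hence their differences 10
    and 16, hence 2.  If [c = 0], then 17 and 11 are powers of [p]. *)
Lemma cofactor_powers_incompatible p m a b c :
  prime p -> odd p ->
  m = 2 + p ^ a -> m = 8 + p ^ b -> m = 18 + p ^ c -> False.
Proof.
move=> p_pr p_odd ma mb mc.
case: c mc => [|c] mc.
  have p17 : p = 17 by apply: (@prime_eq_base _ _ a) => //; lia.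
  by have : p = 11; [apply: (@prime_eq_base _ _ b) => //; lia | rewrite p17].
have pc : p %| p ^ c.+1 by rewrite dvdn_exp.
have pa : p %| p ^ a by rewrite dvdn_exp //; case: a ma => // ma; lia.
have pb : p %| p ^ b by rewrite dvdn_exp //; case: b mb => // mb; lia.
have p10 : p %| 10 by rewrite -(dvdn_addl _ pc) (_ : _ + _ = p ^ b) //; lia.
have p16 : p %| 16 by rewrite -(dvdn_addl _ pc) (_ : _ + _ = p ^ a) //; lia.
have : p %| gcdn 10 16 by rewrite dvdn_gcd p10.
by rewrite dvdn_prime2 // => /eqP p2; rewrite p2 in p_odd.
Qed.

(** * The two infinite families *)

(** The choice [y = 3] makes 3 divide [6 * p ^ 2 - 36] for every [p], so that
    [3 * p ^ 2 = 18 + 3 ^ j]; from [p >= 5] on, 9 divides the right side,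
    so that 3 divides [p]. *)
Lemma six_prime_square p :
  prime p -> odd p -> Meven' (6 * p ^ 2) <= 2 -> p = 3.
Proof.
move=> p_pr p_odd le2; apply/eqP; apply: contraT => p_neq3.
have p_gt1 := prime_gt1 p_pr.
have p_ge5 : 5 <= p by lia.
have p2_ge : 25 <= p ^ 2 by rewrite -[25]/(5 ^ 2) leq_exp2r.
have p2_odd : odd (p ^ 2) by rewrite oddX.
have [|||j def_d] := @forced_prime_power (6 * p ^ 2) 3 3 _ le2 isT isT isT; try lia.
case: j def_d => [|[|j]] def_d; [lia | lia |].
rewrite !expnS in def_d; have three_dvd : 3 %| p ^ 2 by lia.
by move: three_dvd; rewrite Euclid_dvdX // dvdn_prime2 // eq_sym (negPf p_neq3).
Qed.

(** The powers differ by 14, 42 or 70, which are not divisible by 49, so the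
    smaller one, divisible by 7, has to be 7 itself. *)
Lemma power7_gap s u a b :
  s = 2 * u ^ 2 + 7 ^ a -> s = 2 * (7 - u) ^ 2 + 7 ^ b ->
  0 < u <= 3 -> 7 %| s - 2 * u ^ 2 -> s \in [:: 39; 57; 79].
Proof.
move=> sa sb u_range s_mod7; rewrite !inE.
have : u = 1 \/ u = 2 \/ u = 3 by lia.
case: b sb => [|[|b]] sb; last case: a sa => [|[|a]] sa.
all: case=> [u_eq|[]u_eq]; subst u; rewrite ?expnS in sa sb *; lia.
Qed.

Lemma two_prime_square p :
  prime p -> odd p -> Meven' (2 * p ^ 2) <= 2 -> p \in [:: 3; 5; 7].
Proof.
move=> p_pr p_odd le2; apply: contraT => p_large.
have p_gt1 := prime_gt1 p_pr.
have p_ge11 : 11 <= p.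
  move: p_large; rewrite !inE => p_large; rewrite leqNgt; apply/negP => p_lt11.
  have p9 : p = 9 by lia.
  by rewrite p9 in p_pr.
have p2_ge : 121 <= p ^ 2 by rewrite -[121]/(11 ^ 2) leq_exp2r.
have p2_odd : odd (p ^ 2) by rewrite oddX.
have p_mod7 : p %% 7 != 0.
  by apply/negP; rewrite -/(7 %| p) dvdn_prime2 // => /eqP p7; lia.
have power y : 0 < y <= 6 -> 7 %| p ^ 2 - 2 * y ^ 2 ->
    exists j, p ^ 2 = 2 * y ^ 2 + 7 ^ j.
  move=> /andP[y_gt0 y_le6] dvd7.
  have y2_le : y ^ 2 <= 36 by rewrite -[36]/(6 ^ 2) leq_exp2r.
  have [|||j def_d] := @forced_prime_power (2 * p ^ 2) 7 y _ le2 isT isT y_gt0; try lia.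
  by exists j; lia.
(* 3 is a square root of 2 modulo 7, so [u] is [p / 3] or [- p / 3] modulo 7. *)
have [u u_range dvd7] : exists2 u, 0 < u <= 3 & 7 %| p ^ 2 - 2 * u ^ 2.
  have : p ^ 2 %% 7 = (p %% 7) ^ 2 %% 7 by rewrite modnXm.
  have : p %% 7 < 7 by rewrite ltn_mod.
  case: (p %% 7) p_mod7 => [|[|[|[|[|[|[|r]]]]]]] //= _ _ p2_mod7;
    by [exists 1; lia | exists 2; lia | exists 3; lia].
have [a sa] := power u (ltac:(lia)) dvd7.
have [||b sb] := power (7 - u); [lia | |].
  have : u = 1 \/ u = 2 \/ u = 3 by lia.
  by case=> [u_eq|[]u_eq]; subst u; lia.
have := power7_gap sa sb u_range dvd7.
by rewrite !inE; lia.
Qed.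

(** * The classification *)

Lemma Meven'_exceptional d : d \in [:: 18; 50; 54; 90; 98] -> Meven' d <= 2.
Proof.
move=> d_in.
have /allP/(_ _ d_in)/allP check :
  all (fun d => all (fun x => (~~ odd x && (x ^ 2 <= d)) ==> (omega (d - x ^ 2) <= 2))
    (index_iota 2 d.+1)) [:: 18; 50; 54; 90; 98] by vm_compute.
by apply/bigmax_leqP_seq => x /check /implyP.
Qed.

Theorem theorem11 (d : nat) (hd : d = 2 %[mod 4]) (hsq : ~ square_free d) :
  Meven' d <= 2 <-> d \in [:: 18; 50; 54; 90; 98].
Proof.
split=> [le2|]; last exact: Meven'_exceptional.
have [p [m [p_pr p_odd m_odd def_d]]] := odd_prime_square_divisor hd hsq.
have le2m : Meven' (p ^ 2 * (2 * m)) <= 2 by rewrite -def_d.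
have power k := @cofactor_prime_power p m k p_pr p_odd m_odd le2m.
have base q a (q_pr : prime q) : q = p ^ a -> p = q by apply: prime_eq_base.
have [m_ge19|m_lt19] := leqP 19 m.
  have [||a ma] := power 1; [by [] | by lia |].
  have [||b mb] := power 2; [by [] | by lia |].
  have [||c mc] := power 3; [by [] | by lia |].
  by case: (@cofactor_powers_incompatible p m a b c).
have : m \in [:: 1; 3; 5; 7; 9; 11; 13; 15; 17] by rewrite !inE; lia.
clear m_odd m_lt19; rewrite !inE.
do 8?[case/predU1P=> [m_eq|]]; last (move/eqP=> m_eq); subst m.
- have : p \in [:: 3; 5; 7] by apply: two_prime_square; rewrite // mulnC.
  by rewrite !inE def_d => /or3P[] /eqP->.
- suff p3 : p = 3 by rewrite def_d p3.
  by apply: six_prime_square; rewrite // mulnC.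
- have [//|//|a ma] := power 1.
  have p3 : p = 3 by apply: (base 3 a) => //; lia.
  by rewrite def_d p3.
- have [//|//|a ma] := power 1.
  have p5 : p = 5 by apply: (base 5 a) => //; lia.
  (* 350 - 8 ^ 2 = 2 * 11 * 13 *)
  have := leq_trans (@omega_le_Meven' d 8 isT isT _) le2.
  by rewrite def_d p5 => /(_ isT).
- have [//|//|a ma] := power 1.
  have p7 : p = 7 by apply: (base 7 a) => //; lia.
  (* 882 - 6 ^ 2 = 2 * 3 ^ 2 * 47 *)
  have := leq_trans (@omega_le_Meven' d 6 isT isT _) le2.
  by rewrite def_d p7 => /(_ isT).
- have [//|//|a ma] := power 2.
  have p3 : p = 3 by apply: (base 3 a) => //; lia.
  (* 198 - 4 ^ 2 = 2 * 7 * 13 *)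
  have := leq_trans (@omega_le_Meven' d 4 isT isT _) le2.
  by rewrite def_d p3 => /(_ isT).
- have [//|//|a ma] := power 1; have [//|//|b mb] := power 2.
  have p11 : p = 11 by apply: (base 11 a) => //; lia.
  by have : p = 5; [apply: (base 5 b) => //; lia | rewrite p11].
- have [//|//|a ma] := power 1; have [//|//|b mb] := power 2.
  have p13 : p = 13 by apply: (base 13 a) => //; lia.
  by have : p = 7; [apply: (base 7 b) => //; lia | rewrite p13].
- have [//|//|a ma] := power 1.
  (* 15 is not a power of a prime. *)
  have p_a : p ^ a = 15 by lia.
  have : 3 %| p ^ a by rewrite p_a.
  rewrite Euclid_dvdX // dvdn_prime2 // => /andP[/eqP p3 _].
  have : 5 %| p ^ a by rewrite p_a.
  by rewrite Euclid_dvdX // dvdn_prime2 // -p3.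
Qed.
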